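(* Let $\mathcal{I}$ be an ideal on $\mathbb{N}$ with the Baire property. Then there is a rich abstract upper density $\delta$ such that $\mathcal{Z}_\delta=\mathcal{I}$.
   Context: An abstract upper density on $\mathbb{N}$ is a function $\delta:\mathcal{P}(\mathbb{N})\to[0,1]$ such that $\delta(\mathbb{N})=1$; $\delta(F)=0$ for every finite $F\subseteq\mathbb{N}$; $A\subseteq B$ implies $\delta(A)\le\delta(B)$; and $\delta(A\cup B)\le\delta(A)+\delta(B)$. It is rich if for every $r\in[0,1]$ there is $A\subseteq\mathbb{N}$ with $\delta(A)=r$. $\mathcal{Z}_\delta=\{A\subseteq\mathbb{N}:\delta(A)=0\}$. An ideal on $\mathbb{N}$ is a family $\mathcal{I}\subseteq\mathcal{P}(\mathbb{N})$ closed under finite unions and subsets, containing all finite subsets of $\mathbb{N}$, with $\mathbb{N}\notin\mathcal{I}$. Subsets of $\mathbb{N}$ are identified with their characteristic functions, so $\mathcal{P}(\mathbb{N})$ carries the topology of the Cantor space $\{0,1\}^{\mathbb{N}}$; $\mathcal{I}$ has the Baire property if it has the Baire property as a subset of this space (i.e. there is an open $U$ such that the symmetric difference of $\mathcal{I}$ and $U$ is of first category). *)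

(* Defs.v *)
From HB Require Import structures.
From mathcomp Require Import all_boot all_order all_algebra.
From mathcomp Require Import all_classical all_reals all_analysis.
Set Implicit Arguments.
Unset Strict Implicit.
Unset Printing Implicit Defensive.
Import Order.TTheory GRing.Theory Num.Theory.
Local Open Scope classical_set_scope.
Local Open Scope ring_scope.

Definition nowhere_dense (T : topologicalType) (A : set T) : Prop :=
  interior (closure A) = set0.

Definition first_category (T : topologicalType) (A : set T) : Prop :=
  exists F : nat -> set T,
    (forall n, nowhere_dense (F n)) /\ A = \bigcup_n F n.

Definition Baire_property (T : topologicalType) (A : set T) : Prop :=
  exists U : set T, open U /\ first_category (A `+` U).

Definition char_fun (A : set nat) : cantor_space := fun n => `[< A n >].

(* [char_fun] is a bijection from [set nat] onto [cantor_space]; a family of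
   subsets of [nat] is viewed in the Cantor space as its direct image. *)
Definition family_Baire_property (I : set (set nat)) : Prop :=
  Baire_property (char_fun @` I).

Definition is_ideal (I : set (set nat)) : Prop :=
  [/\ forall A B, I A -> I B -> I (A `|` B),
      forall A B, A `<=` B -> I B -> I A,
      forall F, finite_set F -> I F
    & ~ I setT].

Definition abstract_upper_density (R : realType) (d : set nat -> R) : Prop :=
  [/\ forall A, 0 <= d A <= 1,
      d setT = 1,
      forall F, finite_set F -> d F = 0,
      forall A B, A `<=` B -> d A <= d B
    & forall A B, d (A `|` B) <= d A + d B].

Definition rich (R : realType) (d : set nat -> R) : Prop :=
  forall r : R, 0 <= r <= 1 -> exists A, d A = r.

Definition zero_sets (R : realType) (d : set nat -> R) : set (set nat) :=
  [set A | d A = 0].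

(* Main.v *)
(** Agreeing with a fixed point [z] of Cantor space on infinitely many blocks
    of a suitable partition of [nat] into intervals keeps a point out of a given
    meager set. If an ideal [I] were comeager in a cylinder, two of its members
    would agree with [z] on infinitely many even, resp. odd, blocks and contain
    all the other blocks outside a finite set; their union would be cofinite.
    So [I] is meager, and a set containing infinitely many blocks is not in [I]
    (Jalali-Naini, Talagrand).

    Hence there is [g : nat -> [0, 1]] taking each rational value on a set
    outside [I]. By compactness, [A] is in [I] if and only if [g] has no cluster
    value along [A] modulo [I], and the cluster values along [A `|` B] are those
    along [A] or along [B]. So for any positive function [phi] bounded by [1],
    the supremum of [phi] over the cluster values along [A] is a subadditive
    function of [A] that vanishes exactly on [I]. With [phi x = x] for [x > 0]
    and [phi 0 = 1], the sets [{a <= g <= b}] with [a > 0] have density [b]. *)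

Require Import Defs.
From HB Require Import structures.
From mathcomp Require Import all_boot all_order all_algebra.
From mathcomp Require Import all_classical all_reals all_analysis.
From mathcomp Require Import zify lra.
Set Implicit Arguments.
Unset Strict Implicit.
Unset Printing Implicit Defensive.
Import Order.TTheory GRing.Theory Num.Theory.
Import numFieldTopology.Exports.
Local Open Scope classical_set_scope.

Lemma nowhere_dense0 (T : topologicalType) : nowhere_dense (@set0 T).
Proof. by rewrite /nowhere_dense closure0 interior0. Qed.

Lemma nowhere_denseP (T : topologicalType) (A : set T) :
  nowhere_dense A <-> dense (~` closure A).
Proof.
split=> [A0 U U0 Uop|Ad].
  apply: contrapT => UA; have : U `<=` closure A.
    by move=> x Ux; apply: contrapT => Ax; apply: UA; exists x.
  move=> /interiorS; rewrite A0; move/interior_id : Uop => ->.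
  by case: U0 => x Ux /(_ x Ux).
apply/eqP/negPn/negP => /set0P/Ad/(_ (@open_interior _ _))[x [Ax]].
by apply; exact: interior_subset.
Qed.

Lemma nowhere_denseU (T : topologicalType) (A B : set T) :
  nowhere_dense A -> nowhere_dense B -> nowhere_dense (A `|` B).
Proof.
move=> /nowhere_denseP Ad /nowhere_denseP Bd; apply/nowhere_denseP.
rewrite closureU setCU; apply: denseI => //.
exact/closed_openC/closed_closure.
Qed.

Definition eq_between (m n : nat) (x y : cantor_space) : Prop :=
  forall i, m <= i < n -> x i = y i.

Lemma open_eq_between (m n : nat) (x : cantor_space) : open (eq_between m n x).
Proof.
have -> : eq_between m n x =
    \big[setI/setT]_(m <= i < n)
      ((fun y : cantor_space => y i) @^-1` [set x i]).
  rewrite -bigcap_seq; apply/seteqP; split=> y xy i /=.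
    by rewrite mem_index_iota => /xy.
  by move=> imn; rewrite xy //= mem_index_iota.
apply: big_ind => [|A B|i _]; [exact: openT|exact: openI|].
apply: open_comp; last exact: discrete_open.
by move=> y _; exact: (@proj_continuous nat (fun=> bool) i).
Qed.

Lemma nbhs_cantorP (x : cantor_space) (V : set cantor_space) :
  nbhs x V <-> exists n, eq_between 0 n x `<=` V.
Proof.
split=> [|[n nV]]; last first.
  by apply: (filterS nV); apply: open_nbhs_nbhs; split=> //;
    exact: open_eq_between.
pose F : set_system cantor_space :=
  filter_from setT (fun n => eq_between 0 n x).
have FF : Filter F.
  apply: filter_from_filter; first by exists 0.
  move=> m n _ _; exists (maxn m n) => // y xy.
  by split=> i ilt; apply: xy; lia.
suff : F --> x by move=> /[apply] -[n _ nV]; exists n.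
apply/cvg_sup => i A /= [_ [[B Bop <-] Bx BA]].
by exists i.+1 => // y xy; apply: BA; rewrite /= -xy //; lia.
Qed.

Lemma nowhere_dense_avoid (F : set cantor_space) (x : cantor_space) (n : nat) :
  nowhere_dense F ->
  exists m (y : cantor_space), [/\ n <= m, eq_between 0 n x y
    & forall w, eq_between 0 m y w -> ~ F w].
Proof.
move=> /nowhere_denseP/(_ (eq_between 0 n x)).
have x0 : eq_between 0 n x !=set0 by exists x.
move=> /(_ x0 (@open_eq_between 0 n x))[y [xy Fy]].
have : nbhs y (~` closure F).
  by apply: open_nbhs_nbhs; split=> //; exact/closed_openC/closed_closure.
move=> /nbhs_cantorP[m mF]; exists (maxn n m), y; split=> //; first by lia.
move=> w yw /subset_closure; apply: mF => i ilt.
by apply: yw; lia.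
Qed.

Lemma nowhere_dense_avoid_prefixes (F : set cantor_space) (n : nat)
    (s : seq (seq bool)) : nowhere_dense F ->
  exists m (z : cantor_space), n < m /\ forall p, p \in s -> forall w,
    eq_between 0 n (nth false p) w -> eq_between n m z w -> ~ F w.
Proof.
move=> Fnd; elim: s => [|p s [m [z [nm zF]]]]; first by exists n.+1, xpredT.
pose x : cantor_space := fun i => if i < n then nth false p i else z i.
have [m' [y [mm' xy yF]]] := nowhere_dense_avoid x m Fnd.
exists m', y; split=> [|q]; first by lia.
rewrite inE => /orP[/eqP->|qs] w pw yw.
  apply: yF => i ilt; have [iltn|nlei] := ltnP i n; last by apply: yw; lia.
  by rewrite -pw // -xy; [rewrite /x iltn|lia].
apply: (zF _ qs) => // i ilt; rewrite -yw; last by lia.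
by rewrite -xy; [rewrite /x ifN //; lia|lia].
Qed.

Lemma nowhere_dense_avoid_block (F : set cantor_space) (n : nat) :
  nowhere_dense F ->
  exists m (z : cantor_space), n < m /\
    forall w, eq_between n m z w -> ~ F w.
Proof.
move=> /(nowhere_dense_avoid_prefixes n [seq val t | t : n.-tuple bool]).
move=> [m [z [nm zF]]]; exists m, z; split=> // w.
apply: (zF (mkseq w n)) => [|i iltn]; last by rewrite nth_mkseq.
by apply/mapP; exists [tuple of mkseq w n]; rewrite ?mem_enum.
Qed.

Lemma increasing_block_index (N : nat -> nat) :
  N 0 = 0 -> (forall k, N k < N k.+1) ->
  exists f : nat -> nat, (forall i, f i <= i) /\
    forall i k, (f i == k) = (N k <= i < N k.+1).
Proof.
move=> N0 Nlt; have Nmono : {mono N : k l / k <= l}.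
  by apply: leq_mono; apply: homo_ltn => //; exact: ltn_trans.
have /choice[f fN] : forall i, exists k, N k <= i < N k.+1.
  elim=> [|i [k ik]]; first by exists 0; have := Nlt 0; lia.
  have [?|?] := ltnP i.+1 (N k.+1); first by exists k; lia.
  by exists k.+1; have := Nlt k.+1; lia.
exists f; split=> [i|i k].
  have leN k : k <= N k by elim: k => // k; have := Nlt k; lia.
  by have := leN (f i); have := fN i; lia.
apply/eqP/idP => [<-|ik]; first exact: fN.
by have := fN i; have := Nmono (f i).+1 k; have := Nmono k.+1 (f i); lia.
Qed.

Definition contains_infinitely_many_fibers (f : nat -> nat) (A : set nat) :=
  forall K, exists2 k, K <= k & f @^-1` [set k] `<=` A.

Lemma first_category_blocks (M : set cantor_space) : first_category M ->
  exists (f : nat -> nat) (z : cantor_space), (forall i, f i <= i) /\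
    forall w, contains_infinitely_many_fibers f [set i | z i = w i] -> ~ M w.
Proof.
move=> [F [Fnd ->]]; pose G k := \big[setU/set0]_(j < k.+1) F j.
have Gnd k : nowhere_dense (G k).
  apply: big_ind => [|A B|j _]; last exact: Fnd.
  - exact: nowhere_dense0.
  - exact: nowhere_denseU.
have /(_ _)/cid-/all_sig[m] (p : nat * nat) :=
  nowhere_dense_avoid_block p.1 (Gnd p.2).
move=> /(_ _)/cid-/all_sig[z mz].
pose N := fix N k := if k is l.+1 then m (N l, l) else 0.
have [||f [fle fN]] := @increasing_block_index N; first by [].
  by move=> k; have [] := mz (N k, k).
exists f, (fun i => z (N (f i), f i) i); split=> // w wf [j _ Fw].
have [k jk wk] := wf j; have [_ /(_ w)] := mz (N k, k); apply.
  move=> i ik; have /eqP fik : f i == k by rewrite fN.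
  by rewrite -(wk i fik) fik.
by rewrite /G -bigcup_mkord; exists j; rewrite //= ltnS.
Qed.

Lemma enum_infinitely_often (T : countType) (x0 : T) :
  exists h : nat -> T, forall x K, exists2 k, K <= k & h k = x.
Proof.
exists (fun k => odflt x0 (unpickle (logn 2 k))) => x K.
exists (2 ^ pickle x * 3 ^ K).
  by rewrite (leq_trans (ltnW (@ltn_expl 3 K isT)))// leq_pmull ?expn_gt0.
by rewrite lognM ?expn_gt0// pfactorK// lognX (logn_coprime (m := 3))//
  muln0 addn0 pickleK.
Qed.

Lemma char_fun_imageP (I : set (set nat)) (x : cantor_space) :
  (char_fun @` I) x <-> I [set i | x i].
Proof.
split=> [[A IA <-]|Ix].
  suff -> : [set i | char_fun A i] = A by [].
  by apply/seteqP; split=> i /=; rewrite /char_fun => /asboolP.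
by exists [set i | x i] => //; apply/funext => i; rewrite /char_fun /= asboolb.
Qed.

Section ideal.
Context (I : set (set nat)) (idI : is_ideal I).

Lemma idealU A B : I A -> I B -> I (A `|` B).
Proof. by case: idI => + _ _ _; apply. Qed.

Lemma idealS A B : A `<=` B -> I B -> I A.
Proof. by case: idI => _ + _ _; apply. Qed.

Lemma ideal_finite F : finite_set F -> I F.
Proof. by case: idI => _ _ + _; apply. Qed.

Lemma ideal_set0 : I set0.
Proof. exact/ideal_finite/finite_set0. Qed.

Lemma ideal_setTN : ~ I setT.
Proof. by case: idI. Qed.

Hypothesis Baire_I : family_Baire_property I.

Lemma ideal_Baire_first_category : first_category (char_fun @` I).
Proof.
have [U [Uop UM]] := Baire_I.
have [U0|/set0P[u Uu]] := eqVneq U set0; first by move: UM; rewrite U0 setY0.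
have /nbhs_cantorP[n nU] : nbhs u U by exact: open_nbhs_nbhs.
have [f [z [fle fz]]] := first_category_blocks UM.
pose x (b : bool) : cantor_space :=
  fun i => if i < n then u i else (odd (f i) == b) ==> z i.
have Ix b : I [set i | x b i].
  apply/char_fun_imageP; apply: contrapT => nIx; apply: (fz (x b)).
    move=> K; exists ((K + n).*2 + b); first by lia.
    move=> i /= fi; rewrite /x ifN; last by have := fle i; lia.
    by rewrite fi oddD odd_double oddb eqxx.
  by right; split=> //; apply: nU => i /= ilt; rewrite /x ilt.
exfalso; apply: ideal_setTN.
have -> : setT = `I_n `|` ([set i | x true i] `|` [set i | x false i]).
  apply/esym/seteqP; split=> // i _.
  have [ilt|nlei] := ltnP i n; [by left|right].
  by rewrite /= /x ltnNge nlei; case: (odd _); [right|left].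
by apply: idealU; [exact/ideal_finite/finite_II|exact: idealU].
Qed.

Lemma ideal_Baire_blocks :
  exists f : nat -> nat, forall A, contains_infinitely_many_fibers f A -> ~ I A.
Proof.
have [f [z [_ fz]]] := first_category_blocks ideal_Baire_first_category.
exists f => A fA IA; apply: (fz (fun i => `[< A i >] && z i)).
  move=> K; have [k Kk kA] := fA K; exists k => // i /kA Ai /=.
  by rewrite asboolT.
by apply/char_fun_imageP; apply: idealS IA => i /andP[/asboolP].
Qed.

Lemma ideal_Baire_coloring (T : countType) (x0 : T) :
  exists g : nat -> T, forall x, ~ I (g @^-1` [set x]).
Proof.
have [f fI] := ideal_Baire_blocks; have [h hx] := enum_infinitely_often x0.
exists (h \o f) => x; apply: fI => K; have [k Kk <-] := hx x K.
by exists k => // i /= ->.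
Qed.

End ideal.

Local Open Scope ring_scope.

Section cluster_density.
Context (R : realType) (T : topologicalType) (I : set (set nat)).
Context (g : nat -> T) (phi : T -> R).

Definition cluster_values (A : set nat) : set T :=
  [set x | forall U, nbhs x U -> ~ I (A `&` g @^-1` U)].

Definition cluster_density (A : set nat) : R := sup (phi @` cluster_values A).

Hypothesis idI : is_ideal I.

Lemma cluster_valuesS A B : A `<=` B -> cluster_values A `<=` cluster_values B.
Proof.
move=> AB x Ax U /Ax nI IB; apply: nI.
by apply: (idealS idI) IB; exact: setSI.
Qed.

Lemma cluster_valuesU A B :
  cluster_values (A `|` B) = cluster_values A `|` cluster_values B.
Proof.
apply/seteqP; split=> [x ABx|x [|]]; last 2 first.
- by apply: cluster_valuesS; exact: subsetUl.
- by apply: cluster_valuesS; exact: subsetUr.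
apply: contrapT => /not_orP[].
move=> /existsNP[U /not_implyP[xU /contrapT AU]].
move=> /existsNP[V /not_implyP[xV /contrapT BV]].
apply: (ABx (U `&` V)); first exact: filterI.
apply: (idealS idI) (idealU idI AU BV) => i [[Ai|Bi] [Ui Vi]].
- by left.
- by right.
Qed.

Lemma cluster_values_closed A D : closed D -> A `<=` g @^-1` D ->
  cluster_values A `<=` D.
Proof.
move=> Dcl AD x Ax; apply: contrapT => Dx; apply: (Ax (~` D)).
  by apply: open_nbhs_nbhs; split=> //; exact: closed_openC.
apply: (idealS idI) (ideal_set0 idI) => i [/AD Di].
exact.
Qed.

Lemma cluster_values_eq0 K A : compact K -> (forall i, K (g i)) ->
  cluster_values A = set0 <-> I A.
Proof.
move=> Kc gK; split=> [A0|IA]; last first.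
  apply/seteqP; split=> // x /(_ setT filterT); apply.
  by apply: (idealS idI) IA => i [].
apply: contrapT => nIA.
pose F : set_system T := [set B | I (A `\` g @^-1` B)].
have FF : ProperFilter F.
  split=> [FI|]; first by apply/nIA/(idealS idI _ FI) => i Ai; split.
  split=> [|B C FB FC|B C BC].
  - by apply: (idealS idI) (ideal_set0 idI) => i [_]; apply.
  - apply: (idealS idI) (idealU idI FB FC) => i [Ai /not_andP[nB|nC]].
    + by left.
    + by right.
  - by apply: (idealS idI) => i [Ai nC]; split=> // /BC.
have [|x [_ xF]] := Kc F FF.
  by apply: (idealS idI) (ideal_set0 idI) => i [_]; apply.
suff : cluster_values A x by rewrite A0.
move=> U xU IU; have FU : F (~` U).
  by apply: (idealS idI) IU => i [Ai /contrapT].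
by have [y []] := xF _ _ FU xU.
Qed.

Hypothesis phi01 : forall x, 0 < phi x <= 1.

Lemma le_cluster_density A x : cluster_values A x -> phi x <= cluster_density A.
Proof.
move=> Ax; apply: ub_le_sup; last by exists x.
by exists 1 => _ [y _ <-]; have /andP[] := phi01 y.
Qed.

Lemma cluster_density_le A t : 0 <= t ->
  (forall x, cluster_values A x -> phi x <= t) -> cluster_density A <= t.
Proof.
move=> t0 At; rewrite /cluster_density.
have [->|/set0P[x Ax]] := eqVneq (cluster_values A) set0.
  by rewrite image_set0 sup0.
by apply: ge_sup => [|_ [y /At ? <-]]; [exists (phi x); exists x|].
Qed.

Lemma cluster_density_eq0 A :
  cluster_density A = 0 <-> cluster_values A = set0.
Proof.
split=> [d0|A0]; last by rewrite /cluster_density A0 image_set0 sup0.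
apply/seteqP; split=> // x /le_cluster_density; rewrite d0.
by have := phi01 x; lra.
Qed.

Lemma cluster_density_ge0 A : 0 <= cluster_density A.
Proof.
have [/cluster_density_eq0->//|/set0P[x]] := eqVneq (cluster_values A) set0.
by move=> /le_cluster_density; have := phi01 x; lra.
Qed.

Lemma abstract_upper_density_cluster K x : compact K -> (forall i, K (g i)) ->
  cluster_values setT x -> phi x = 1 -> abstract_upper_density cluster_density.
Proof.
move=> Kc gK xT x1.
have dle1 A : cluster_density A <= 1.
  by apply: cluster_density_le => // y _; have /andP[] := phi01 y.
split=> [A||F Ffin|A B AB|A B].
- by rewrite cluster_density_ge0 dle1.
- by apply/eqP; rewrite eq_le dle1 -x1 le_cluster_density.
- apply/cluster_density_eq0/(cluster_values_eq0 F Kc gK).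
  exact: (ideal_finite idI).
- apply: cluster_density_le => [|y Ay]; first exact: cluster_density_ge0.
  by apply: le_cluster_density; exact: cluster_valuesS Ay.
- apply: cluster_density_le => [|y].
    by rewrite addr_ge0 ?cluster_density_ge0.
  have := cluster_density_ge0 A; have := cluster_density_ge0 B.
  by rewrite cluster_valuesU => + + [] /le_cluster_density; lra.
Qed.

End cluster_density.

Lemma ratr_itv01 (R : realType) (q : rat) :
  (0 <= (ratr q : R) <= 1) = (0 <= q <= 1).
Proof. by rewrite -[1 in LHS](rmorph1 (@ratr R)) ler0q ler_rat. Qed.

Lemma ideal_Baire_rat_values (R : realType) (I : set (set nat)) :
  is_ideal I -> family_Baire_property I ->
  exists g : nat -> R, (forall i, 0 <= g i <= 1) /\
    forall q : rat, 0 <= q <= 1 -> ~ I (g @^-1` [set ratr q]).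
Proof.
move=> idI BI; pose Q01 := {q : rat | 0 <= q <= 1}.
have [c cI] := ideal_Baire_coloring idI BI (exist _ 0 isT : Q01).
exists (fun i => ratr (val (c i))); split=> [i|q q01].
  by rewrite ratr_itv01; exact: valP (c i).
by apply: contra_not (cI (exist _ q q01)); apply: (idealS idI) => i /= ->.
Qed.

Section limsup_density.
Context (R : realType) (I : set (set nat)) (g : nat -> R).
Hypothesis idI : is_ideal I.
Hypothesis g01 : forall i, 0 <= g i <= 1.
Hypothesis gQ : forall q : rat, 0 <= q <= 1 -> ~ I (g @^-1` [set ratr q]).

Lemma cluster_values_itv_right (a b : R) : 0 <= a -> a < b -> b <= 1 ->
  cluster_values I g (g @^-1` `[a, b]) b.
Proof.
move=> a0 ab b1 U /nbhs_ballP[e /= e0 eU].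
have [|q] := @rat_in_itvoo R (Num.max a (b - e)) b.
  by rewrite gt_max; lra.
rewrite in_itv /= gt_max => /andP[/andP[aq eq] qb] IU.
apply: (@gQ q); first by rewrite -(ratr_itv01 R); lra.
apply: (idealS idI) IU => i /= ->; split; first by rewrite /= in_itv /=; lra.
by apply: eU; rewrite /ball /= ltr_distl; lra.
Qed.

(* As [g] has values in [0, 1], only the value at [0] matters; it is positive
   because a set outside [I] along which [g] tends to [0] must not be null. *)
Definition id_or_one (x : R) : R := if 0 < x <= 1 then x else 1.

Lemma id_or_one_gt0_le1 x : 0 < id_or_one x <= 1.
Proof. by rewrite /id_or_one; case: ifP => //; rewrite ltr01 lexx. Qed.

Lemma id_or_one_id x : 0 < x <= 1 -> id_or_one x = x.
Proof. by rewrite /id_or_one => ->. Qed.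

Definition limsup_density : set nat -> R := cluster_density I g id_or_one.

Lemma limsup_density_itv (a b : R) : 0 < a -> a < b -> b <= 1 ->
  limsup_density (g @^-1` `[a, b]) = b.
Proof.
move=> a0 ab b1; apply/eqP; rewrite eq_le; apply/andP; split.
  apply: cluster_density_le => [|x gx]; first by lra.
  have : `[a, b]%classic x.
    by apply: (cluster_values_closed idI _ _ gx); first exact: itv_closed.
  by rewrite /= in_itv /= => abx; rewrite id_or_one_id; lra.
rewrite -{1}(@id_or_one_id b); last by lra.
apply: le_cluster_density; first exact: id_or_one_gt0_le1.
by apply: cluster_values_itv_right => //; lra.
Qed.

Lemma abstract_upper_density_limsup : abstract_upper_density limsup_density.
Proof.
have /(cluster_valuesS idI (@subsetT _ _)) cvT1 :=
  cluster_values_itv_right (lexx 0) ltr01 (lexx 1).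
apply: abstract_upper_density_cluster (@segment_compact R 0 1) _ cvT1 _ => //.
- exact: id_or_one_gt0_le1.
- by rewrite id_or_one_id// ltr01 lexx.
Qed.

Lemma limsup_density_eq0 A : limsup_density A = 0 <-> I A.
Proof.
rewrite /limsup_density cluster_density_eq0; last exact: id_or_one_gt0_le1.
apply: (cluster_values_eq0 idI _ (@segment_compact R 0 1)) => i.
by rewrite /= in_itv /=.
Qed.

Lemma rich_limsup_density : rich limsup_density.
Proof.
move=> r /andP[]; rewrite le_eqVlt => /predU1P[<- _|r0 r1].
  by exists set0; apply/limsup_density_eq0; exact: ideal_set0 idI.
by exists (g @^-1` `[r / 2, r]); apply: limsup_density_itv => //; lra.
Qed.

End limsup_density.

Theorem theorem2p2 (R : realType) (I : set (set nat)) :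
  is_ideal I -> family_Baire_property I ->
  exists d : set nat -> R,
    [/\ abstract_upper_density d, rich d & zero_sets d = I].
Proof.
move=> idI BI; have [g [g01 gQ]] := ideal_Baire_rat_values R idI BI.
exists (limsup_density I g); split.
- exact: abstract_upper_density_limsup idI g01 gQ.
- exact: rich_limsup_density idI g01 gQ.
- by apply/seteqP; split=> A /(limsup_density_eq0 idI g01).
Qed.
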